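(* Let $\hat X$ be a Dynkin diagram, $X\subset\hat X$ a subdiagram, $Y=\hat X\setminus X$, and let $\hat P$ be a weight lattice of $\hat X$. Let $\phi\in\hat P^{+}$ be a dominant weight and let $w\in\hat W$ be an $X$-reduced element. Suppose that the $Y$-coefficient of $\phi-w\cdot\phi$ is $j$. Then $w\in W(Y_{(j)})$, where $Y_{(j)}\subset\hat X$ is the subdiagram of all vertices at distance less than $j$ from $Y$.
   Context: $\hat X$ is a Dynkin diagram (possibly infinite), with root system $\hat\Delta=\hat\Delta^+\sqcup\hat\Delta^-$, simple roots $\alpha_x$ and simple coroots $\alpha_x^\vee$ ($x\in\hat X$), root lattice $\hat Q$, coroot lattice $\hat Q^\vee$, and Weyl group $\hat W$ generated by simple reflections $s_x$. For a subdiagram $Z\subset\hat X$ (a subset of vertices with the induced diagram), $\Delta(Z)\subset\hat\Delta$ is its root system and $W(Z)\subset\hat W$ is the subgroup generated by $s_x$, $x\in Z$. A weight lattice $\hat P$ is a $\mathbb{Z}$-module with an embedding $\hat Q\to\hat P$ and a pairing $\hat P\otimes\hat Q^\vee\to\mathbb{Z}$ extending the standard pairing $\hat Q\otimes\hat Q^\vee\to\mathbb{Z}$; $\hat P^+$ is the set of $\phi\in\hat P$ with $\langle\phi,\alpha_x^\vee\rangle\ge0$ for all $x\in\hat X$. The dot action of $\hat W$ on $\hat P$ is given by $s_x\cdot\phi=\phi-(\langle\phi,\alpha_x^\vee\rangle+1)\alpha_x$. The set of inversion roots of $w$ is $I(w)=\hat\Delta^+\cap w(\hat\Delta^-)$;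 $w$ is $X$-reduced if $I(w)\cap\Delta(X)=\emptyset$. The $Y$-coefficient of $\gamma=\sum_{x\in\hat X}c_x\alpha_x\in\hat Q$ is $\sum_{y\in Y}c_y$. The distance between two vertices is the minimal number of edges of a path connecting them (infinite if there is none), and the distance from a vertex to $Y$ is the minimum over vertices of $Y$. *)

(* Defs.v *)
From HB Require Import structures.
From mathcomp Require Import all_boot all_order all_algebra.
From mathcomp Require Import ring.
From mathcomp Require Import boolp classical_sets functions.
From mathcomp.multinomials Require Import freeg.

Set Implicit Arguments.
Unset Strict Implicit.
Unset Printing Implicit Defensive.

Import Order.TTheory GRing.Theory Num.Theory.

Local Open Scope classical_set_scope.
Local Open Scope ring_scope.

(* A Dynkin diagram, finite or infinite, is encoded by its generalized Cartan
   matrix: [cartan x y] is the pairing of the simple root of [y] with the simple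
   coroot of [x].  Neither symmetrizability nor local finiteness is assumed. *)
Record dynkin := Dynkin {
  vertex :> choiceType;
  cartan : vertex -> vertex -> int;
  cartan_diag : forall x, cartan x x = 2;
  cartan_offdiag : forall x y, x != y -> cartan x y <= 0;
  cartan_eq0 : forall x y, cartan x y = 0 -> cartan y x = 0
}.

Definition rootLattice (D : dynkin) : zmodType := {freeg D / int}.
Definition corootLattice (D : dynkin) : zmodType := {freeg D / int}.

Definition simple_root (D : dynkin) (x : D) : rootLattice D := << x >>.
Definition simple_coroot (D : dynkin) (x : D) : corootLattice D := << x >>.

Definition std_pairing (D : dynkin) (g : rootLattice D) (h : corootLattice D)
    : int :=
  \sum_(x <- dom h) \sum_(y <- dom g) coeff x h * (coeff y g * cartan x y).

Definition set_coeff (D : dynkin) (Z : set D) (g : rootLattice D) : int :=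
  \sum_(x <- dom g | x \in Z) coeff x g.

Record weightLattice (D : dynkin) := WeightLattice {
  weight :> zmodType;
  root_emb : rootLattice D -> weight;
  pairing : weight -> corootLattice D -> int;
  root_emb_additive : {morph root_emb : g1 g2 / g1 + g2};
  root_emb_inj : injective root_emb;
  pairingDl : forall h, {morph pairing^~ h : p q / p + q};
  pairingDr : forall p, {morph pairing p : h k / h + k};
  pairing_root : forall g h, pairing (root_emb g) h = std_pairing g h
}.

Arguments root_emb {D} w _ : simpl never.
Arguments pairing {D w} _ _ : simpl never.

Definition dominant (D : dynkin) (P : weightLattice D) : set P :=
  [set phi | forall x, 0 <= pairing phi (simple_coroot x)].

Definition reflection (D : dynkin) (P : weightLattice D) (x : D) (phi : P) : P :=
  phi - root_emb P (simple_root x) *~ pairing phi (simple_coroot x).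

Lemma sum_dom_additive (K : choiceType) (F : K -> int) :
  {morph (fun h : {freeg K / int} => \sum_(x <- dom h) coeff x h * F x)
     : h k / h + k}.
Proof.
pose f := fglift (F : K -> int^o).
have fB : {morph f : h k / h - k} by exact: lift_is_additive.
pose L : {additive {freeg K / int} -> int^o} :=
  HB.pack f (GRing.isZmodMorphism.Build _ _ f fB).
have fE h : \sum_(x <- dom h) coeff x h * F x = L h.
  rewrite -{3}(freeg_sumE h) raddf_sum.
  by apply: eq_bigr => x _; rewrite /= /f liftU.
by move=> h k; rewrite !fE raddfD.
Qed.

Lemma std_pairingDr (D : dynkin) (g : rootLattice D) :
  {morph std_pairing g : h k / h + k}.
Proof.
move=> h k; rewrite /std_pairing.
under eq_bigr do rewrite -big_distrr /=.
under [X in _ = X + _]eq_bigr do rewrite -big_distrr /=.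
under [X in _ = _ + X]eq_bigr do rewrite -big_distrr /=.
exact: (@sum_dom_additive D).
Qed.

Lemma std_pairingDl (D : dynkin) (h : corootLattice D) :
  {morph (std_pairing (D := D))^~ h : g1 g2 / g1 + g2}.
Proof.
move=> g1 g2; rewrite /std_pairing -big_split /=; apply: eq_bigr => x _.
by rewrite -!big_distrr -mulrDr /= (sum_dom_additive (cartan x)).
Qed.

(* The weight lattice with fundamental weights: [(g, f)] stands for the sum of
   the root lattice element [g] and of [f x] times the fundamental weight of [x],
   for all vertices [x]. *)
Section FundamentalLattice.
Variable D : dynkin.

Let fund : zmodType := (rootLattice D * (D -> int))%type.

Let femb (g : rootLattice D) : fund := (g, 0).

Let fpair (p : fund) (h : corootLattice D) : int :=
  std_pairing p.1 h + \sum_(x <- dom h) coeff x h * p.2 x.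

Let femb_additive : {morph femb : g1 g2 / g1 + g2}.
Proof. by move=> g1 g2; rewrite /femb; congr (_, _); rewrite addr0. Qed.

Let femb_inj : injective femb.
Proof. by move=> g1 g2 []. Qed.

Let fpairDl h : {morph fpair^~ h : p q / p + q}.
Proof.
move=> p q; rewrite /fpair /= std_pairingDl addrACA; congr (_ + _).
by rewrite -big_split /=; apply: eq_bigr => x _; rewrite -mulrDr.
Qed.

Let fpairDr p : {morph fpair p : h k / h + k}.
Proof.
by move=> h k; rewrite /fpair std_pairingDr sum_dom_additive addrACA.
Qed.

Let fpair_root g h : fpair (femb g) h = std_pairing g h.
Proof. by rewrite /fpair big1 ?addr0 // => x _; rewrite mulr0. Qed.

Definition fundLattice : weightLattice D :=
  WeightLattice femb_additive femb_inj fpairDl fpairDr fpair_root.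

End FundamentalLattice.

(* The Weyl group is the group of automorphisms of [fundLattice D] generated by the
   simple reflections; these being involutions, its elements are their products.
   Because the simple coroots are linearly independent on this lattice, an
   automorphism in the group determines the dot action on every weight lattice, see
   [dot]. *)
Definition reflections (D : dynkin) (s : seq D) :
    fundLattice D -> fundLattice D :=
  foldr (fun x f => reflection x \o f) id s.

Record weyl (D : dynkin) := Weyl {
  weyl_fun :> fundLattice D -> fundLattice D;
  weyl_funP : exists s, weyl_fun = reflections s
}.

Lemma weylP (D : dynkin) (u v : weyl D) : u =1 v -> u = v.
Proof.
case: u v => [f fP] [g gP] /= /funext fg.
by case: _ / fg gP => gP; congr Weyl; apply: Prop_irrelevance.
Qed.

Lemma pairingBl (D : dynkin) (P : weightLattice D) h :
  {morph (@pairing D P)^~ h : p q / p - q}.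
Proof. by move=> p q; apply/(addIr (pairing q h)); rewrite -pairingDl !subrK. Qed.

Lemma root_embB (D : dynkin) (P : weightLattice D) :
  {morph root_emb P : p q / p - q}.
Proof. by move=> p q; apply/(addIr (root_emb P q)); rewrite -root_emb_additive !subrK. Qed.

Lemma root_embMz (D : dynkin) (P : weightLattice D) n :
  {morph root_emb P : p / p *~ n}.
Proof.
move=> p; pose f : {additive _ -> _} := HB.pack (root_emb P)
  (GRing.isZmodMorphism.Build _ _ (root_emb P) (@root_embB _ P)).
exact: (raddfMz f).
Qed.

Lemma pairingMzl (D : dynkin) (P : weightLattice D) h n :
  {morph (@pairing D P)^~ h : p / p *~ n}.
Proof.
move=> p; pose f : {additive P -> int} := HB.pack ((@pairing D P)^~ h)
  (GRing.isZmodMorphism.Build _ _ _ (@pairingBl _ P h)).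
exact: (raddfMz f).
Qed.

Lemma pairing_simple (D : dynkin) (P : weightLattice D) (x y : D) :
  pairing (root_emb P (simple_root y)) (simple_coroot x) = cartan x y.
Proof.
rewrite pairing_root /std_pairing !domU1 !big_seq1.
by rewrite /simple_root /simple_coroot !coeffU !eqxx !mul1r.
Qed.

Lemma reflectionE (D : dynkin) (P : weightLattice D) (x : D) (p : P) :
  reflection x p
  = p - root_emb P (simple_root x *~ pairing p (simple_coroot x)).
Proof. by rewrite root_embMz. Qed.

Lemma reflectionK (D : dynkin) (P : weightLattice D) (x : D) :
  involutive (@reflection D P x).
Proof.
move=> p; rewrite /reflection pairingBl pairingMzl pairing_simple cartan_diag.
set n := pairing p _.
have -> : n - 2 *~ n = - n by rewrite mulrzz; ring.
by rewrite mulrNz opprK subrK.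
Qed.

Lemma reflections_cat (D : dynkin) (s t : seq D) :
  reflections (s ++ t) = reflections s \o reflections t.
Proof. by elim: s => //= x s ->. Qed.

Lemma reflections_revK (D : dynkin) (s : seq D) :
  cancel (reflections s) (reflections (rev s)).
Proof.
elim: s => //= x s IH p.
by rewrite rev_cons -cats1 reflections_cat /= reflectionK IH.
Qed.

Section WeylGroup.
Variable D : dynkin.
Implicit Types u v w : weyl D.

HB.instance Definition _ := gen_eqMixin (weyl D).
HB.instance Definition _ := gen_choiceMixin (weyl D).

Fact weyl_one_subproof : exists s, id = reflections (s : seq D).
Proof. by exists [::]. Qed.

Fact weyl_mul_subproof u v : exists s, u \o v = reflections s.
Proof.
have [[s us] [t vt]] := (weyl_funP u, weyl_funP v).
by exists (s ++ t); rewrite us vt reflections_cat.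
Qed.

Fact weyl_inv_subproof u :
  exists2 f : fundLattice D -> fundLattice D, cancel u f & exists s, f = reflections s.
Proof.
have [s ->] := weyl_funP u; exists (reflections (rev s)); last by exists (rev s).
exact: reflections_revK.
Qed.

Fact srefl_subproof (x : D) : exists s, reflection x = reflections s.
Proof. by exists [:: x]. Qed.

Definition weyl_one : weyl D := Weyl weyl_one_subproof.
Definition weyl_mul u v : weyl D := Weyl (weyl_mul_subproof u v).
Definition weyl_inv u : weyl D := Weyl (s2valP' (cid2 (weyl_inv_subproof u))).

Fact weyl_mulA : associative weyl_mul.
Proof. by move=> u v w; apply: weylP. Qed.
Fact weyl_1mul : left_id weyl_one weyl_mul.
Proof. by move=> u; apply: weylP. Qed.
Fact weyl_mul1 : right_id weyl_one weyl_mul.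
Proof. by move=> u; apply: weylP. Qed.
Fact weyl_mulV : left_inverse weyl_one weyl_inv weyl_mul.
Proof. by move=> u; apply: weylP => p /=; exact: (s2valP (cid2 (weyl_inv_subproof u))). Qed.
Fact weyl_Vmul : right_inverse weyl_one weyl_inv weyl_mul.
Proof.
move=> u; rewrite -[LHS]weyl_1mul -{1}(weyl_mulV (weyl_inv u)).
by rewrite -weyl_mulA [weyl_mul (weyl_inv u) _]weyl_mulA weyl_mulV weyl_1mul weyl_mulV.
Qed.

HB.instance Definition _ := isGroup.Build (weyl D)
  weyl_mulA weyl_1mul weyl_mul1 weyl_mulV weyl_Vmul.

Definition simple_reflection (x : D) : weyl D := Weyl (srefl_subproof x).

Definition parabolic (Z : set D) : set (weyl D) :=
  [set w | exists2 s : seq D, (forall x, x \in s -> Z x)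
                            & w = (\prod_(x <- s) simple_reflection x)%g].

Definition weyl_act w (g : rootLattice D) : rootLattice D :=
  (w (root_emb (fundLattice D) g)).1.

(* Let [l] be the combination of fundamental weights having the same pairings as
   [phi] with all coroots, and [rho] the sum of the fundamental weights.  Then
   [w . phi - phi] is the element [w (l + rho) - (l + rho)] of the root lattice.
   [dot1], [dotM] and [dot_simple] below characterize [dot]. *)
Definition dot (P : weightLattice D) w (phi : P) : P :=
  phi + root_emb P (w (0, fun x => pairing phi (simple_coroot x) + 1)).1.

(* The root system of the subdiagram [Z] consists of its real roots.  Since [W]
   permutes the positive imaginary roots, the latter never are inversion roots. *)
Definition root_system (Z : set D) : set (rootLattice D) :=
  [set g | exists w x, [/\ parabolic Z w, Z x & g = weyl_act w (simple_root x)]].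

Definition positive_roots : set (rootLattice D) :=
  root_system setT `&` [set g | forall x, 0 <= coeff x g].

Definition negative_roots : set (rootLattice D) :=
  root_system setT `&` [set g | forall x, coeff x g <= 0].

Definition inversions w : set (rootLattice D) :=
  positive_roots `&` weyl_act w @` negative_roots.

Definition X_reduced (X : set D) w : Prop := inversions w `&` root_system X = set0.

Lemma weyl_ind (K : weyl D -> Prop) :
  K 1%g -> (forall x w, K w -> K (simple_reflection x * w)%g) -> forall w, K w.
Proof.
move=> K1 KS w; have [s ws] := weyl_funP w.
have {ws}-> : w = (\prod_(x <- s) simple_reflection x)%g.
  apply: weylP => p; rewrite ws; elim: s {ws} p => [|x s IH] p.
    by rewrite big_nil.
  by rewrite big_cons /= IH.
by elim: s => [|x s IH]; rewrite ?big_nil ?big_cons //; apply: KS.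
Qed.

Lemma weylB w : {morph w : p q / p - q}.
Proof.
elim/weyl_ind: w => // x w IH p q; rewrite /= IH.
rewrite /reflection pairingBl mulrzBr !opprB addrACA [RHS]addrACA.
by congr (_ + _); rewrite addrC.
Qed.

Lemma weyl_snd w p : (w p).2 = p.2.
Proof.
elim/weyl_ind: w => // x w IH; rewrite -IH.
by rewrite [LHS](congr1 snd (reflectionE x (w p))) /= subr0.
Qed.

Lemma fund_pairing (g : rootLattice D) (f : D -> int) x :
  pairing ((g, f) : fundLattice D) (simple_coroot x)
  = std_pairing g (simple_coroot x) + f x.
Proof.
rewrite /pairing /= domU1 big_seq1 /=; congr (_ + _).
by rewrite /simple_coroot coeffU eqxx !mul1r.
Qed.

Lemma weyl_fixed w p : (forall x, pairing p (simple_coroot x) = 0) -> w p = p.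
Proof.
move=> p0; elim/weyl_ind: w => // x w IH /=.
by rewrite IH /reflection p0 subr0.
Qed.

Lemma weyl_actE w g :
  w (root_emb (fundLattice D) g) = root_emb (fundLattice D) (weyl_act w g).
Proof. by rewrite [LHS]surjective_pairing weyl_snd. Qed.

Lemma weyl_act1 g : weyl_act 1%g g = g.
Proof. by []. Qed.

Lemma weyl_actM u v g : weyl_act (u * v)%g g = weyl_act u (weyl_act v g).
Proof. by rewrite /weyl_act /= -/(weyl_act v g) -weyl_actE. Qed.

Lemma weyl_act_simple x g :
  weyl_act (simple_reflection x) g
  = g - simple_root x *~ std_pairing g (simple_coroot x).
Proof.
rewrite /weyl_act [LHS](congr1 fst (reflectionE (P := fundLattice D) x _)).
by rewrite pairing_root.
Qed.

Lemma dot1 (P : weightLattice D) (phi : P) : dot 1%g phi = phi.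
Proof. by rewrite /dot /= -(subrr 0) root_embB subrr addr0. Qed.

Lemma dot_simple (P : weightLattice D) x (phi : P) :
  dot (simple_reflection x) phi
  = phi - root_emb P (simple_root x) *~ (pairing phi (simple_coroot x) + 1).
Proof.
rewrite /dot [X in root_emb P X](congr1 fst (reflectionE (P := fundLattice D) x _)).
rewrite fund_pairing -[0 : rootLattice D]/(0 : {freeg D / int}).
have -> : std_pairing 0 (simple_coroot x) = 0.
  by rewrite /std_pairing big1 // => y _; rewrite dom0 big_nil.
have e0 : root_emb P 0 = 0 by rewrite -(subrr 0) root_embB subrr.
by rewrite add0r /= root_embB e0 sub0r root_embMz.
Qed.

Lemma dot_root_lattice (P : weightLattice D) w (phi : P) :
  exists g, phi - dot w phi = root_emb P g.
Proof.
exists (0 - (w (0, fun x => pairing phi (simple_coroot x) + 1)).1).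
have e0 : root_emb P 0 = 0 by rewrite -(subrr 0) root_embB subrr.
by rewrite root_embB e0 sub0r /dot opprD addrA subrr sub0r.
Qed.

Lemma dotM (P : weightLattice D) u v (phi : P) :
  dot (u * v)%g phi = dot u (dot v phi).
Proof.
pose rhoshift q : fundLattice D := (0, fun x => pairing (q : P) (simple_coroot x) + 1).
pose d := (v (rhoshift phi)).1.
have vE : v (rhoshift phi) = rhoshift (phi + root_emb P d)
            + (v (rhoshift phi) - rhoshift (phi + root_emb P d)).
  by rewrite addrC subrK.
rewrite /dot /= -/(rhoshift _) -/d -/(rhoshift _) -addrA -root_emb_additive.
congr (_ + root_emb P _); rewrite vE.
set r := rhoshift _; set p := v _ - r.
have pE : p = (d, fun x => - std_pairing d (simple_coroot x)).
  rewrite [p]surjective_pairing; congr (_, _); first exact: subr0.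
  apply/funext => x.
  have -> : p.2 x = (v (rhoshift phi)).2 x - r.2 x by [].
  rewrite weyl_snd /= pairingDl pairing_root.
  by ring.
have p0 x : pairing p (simple_coroot x) = 0 by rewrite pE fund_pairing subrr.
have uD q : u (q + p) = u q + p.
  by rewrite -{2}(addrK p q) weylB (weyl_fixed u p0) subrK.
by rewrite uD pE addrC.
Qed.

End WeylGroup.

Definition adjacent (D : dynkin) : rel D := [rel x y | (x != y) && (cartan x y != 0)].

(* The least element of a set of natural numbers, [None] (infinity) if there is
   none. *)
Definition least (A : set nat) : option nat :=
  if pselect (exists n, `[< A n >]) is left A0 then Some (ex_minn A0) else None.

Definition distance (D : dynkin) (x y : D) : option nat :=
  least [set n | exists2 p, path (@adjacent D) x p & last x p = y /\ size p = n].

Definition distance_to (D : dynkin) (Y : set D) (x : D) : option nat :=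
  least [set n | exists2 y, Y y & distance x y = Some n].

Definition nearby (D : dynkin) (Y : set D) (j : int) : set D :=
  [set x | exists2 n : nat, distance_to Y x = Some n & n%:Z < j].

(* Main.v *)
From HB Require Import structures.
Require Import Defs.
From mathcomp Require Import all_boot all_order all_algebra.
From mathcomp Require Import boolp classical_sets functions.
From mathcomp Require Import zify ring.
From mathcomp.multinomials Require Import freeg.

Set Implicit Arguments.
Unset Strict Implicit.
Unset Printing Implicit Defensive.

Import Order.TTheory GRing.Theory Num.Theory.

Local Open Scope classical_set_scope.
Local Open Scope ring_scope.

(** Let s_1 ... s_n be a reduced word of w, let a_1, ..., a_n be the corresponding
    simple roots, and put b_i = s_1 ... s_(i-1) a_i.  Each b_i is a nonnegative
    combination of simple roots, and w^-1 b_i a nonpositive one.  Telescoping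
    phi - w . phi along the word gives
      [phi - w . phi = sum_i (<phi, a_i^vee> + 1) b_i],
    where all the numbers <phi, a_i^vee> + 1 are at least 1.

    If w is X-reduced, then w^-1 a_x is nonnegative for all x in X; hence a b_i
    supported in X would be sent by w^-1 to a nonnegative vector, which must then
    vanish.  So the Y-coefficient of each b_i is at least 1
    ([X_reduced_set_coeff]), and summing gives n <= j ([size_le_set_coeff]).

    On the other hand, applying s_y to a vector modifies its y-coordinate only, and
    does so only when y is in the support or adjacent to it.  So b_i is supported in
    the ball of radius i - 1 around the i-th letter ([word_support]).  As b_i has a
    vertex of Y in its support, the i-th letter is at distance at most i - 1 < n <= j
    from Y.

    The only fact on Weyl groups that this uses is that w a_x is nonnegative whenever
    w s_x is not shorter than w ([ascent_positive]).  It is proved by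
    induction on the length of w, by the usual reduction to the dihedral subgroups
    generated by two simple reflections.  There, the coordinates of the roots satisfy
    a two-term linear recurrence governed by the product N of the two off-diagonal
    Cartan entries: for N >= 4 its solutions stay nonnegative for ever, and for N < 4
    they do so as long as the braid relation does not shorten the word. *)

(** * Words in the simple reflections *)

Definition word (D : dynkin) (s : seq D) : weyl D :=
  (\prod_(x <- s) simple_reflection x)%g.

Lemma word_nil (D : dynkin) : word [::] = 1%g :> weyl D.
Proof. exact: big_nil. Qed.

Lemma word_cons (D : dynkin) (x : D) s :
  word (x :: s) = (simple_reflection x * word s)%g.
Proof. exact: big_cons. Qed.

Lemma word_cat (D : dynkin) (s t : seq D) :
  word (s ++ t) = (word s * word t)%g.
Proof. exact: big_cat. Qed.

Lemma word_rcons (D : dynkin) (x : D) s :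
  word (rcons s x) = (word s * simple_reflection x)%g.
Proof. by rewrite -cats1 word_cat word_cons word_nil mulg1. Qed.

Lemma srefl_sqr (D : dynkin) (x : D) :
  (simple_reflection x * simple_reflection x = 1)%g.
Proof. by apply: weylP => p; exact: reflectionK. Qed.

Lemma sreflK (D : dynkin) (x : D) (w : weyl D) :
  (w * simple_reflection x * simple_reflection x = w)%g.
Proof. by rewrite -mulgA srefl_sqr mulg1. Qed.

Lemma wordV (D : dynkin) (s : seq D) : ((word s)^-1 = word (rev s))%g.
Proof.
elim: s => [|x s IH]; first by rewrite word_nil invg1.
rewrite rev_cons word_rcons -IH word_cons invgM; congr (_ * _)%g.
by rewrite -[LHS]mulg1 -(srefl_sqr x) mulgA mulVg mul1g.
Qed.

Lemma word_reflections (D : dynkin) (s : seq D) : word s =1 reflections s.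
Proof. by elim: s => [|x s IH] p; rewrite ?word_nil ?word_cons //= IH. Qed.

Lemma exists_word (D : dynkin) (w : weyl D) : exists s, w = word s.
Proof.
elim/weyl_ind: w => [|x w [s ->]]; first by exists [::]; rewrite word_nil.
by exists (x :: s); rewrite word_cons.
Qed.

(** * Linearity of the action on the root lattice *)

Lemma weyl_actB (D : dynkin) (w : weyl D) : {morph weyl_act w : g h / g - h}.
Proof. by move=> g h; rewrite /weyl_act root_embB weylB. Qed.

HB.instance Definition _ (D : dynkin) (w : weyl D) :=
  GRing.isZmodMorphism.Build _ _ (weyl_act w) (@weyl_actB D w).

Lemma coeff_simple (D : dynkin) (x z : D) :
  coeff z (simple_root x) = (x == z)%:R.
Proof. by rewrite coeffU mul1r. Qed.

Lemma coeffMz (D : dynkin) (z : D) (g : rootLattice D) n :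
  coeff z (g *~ n) = coeff z g * n.
Proof. by rewrite raddfMz mulrzz. Qed.

Lemma weyl_actE_sum (D : dynkin) (w : weyl D) (g : rootLattice D) :
  weyl_act w g = \sum_(x <- dom g) weyl_act w (simple_root x) *~ coeff x g.
Proof.
rewrite -{1}[g](freeg_sumE g) raddf_sum; apply: eq_bigr => x _ /=.
rewrite -raddfMz; congr weyl_act; apply/eqP/freeg_eqP => z.
by rewrite coeffMz coeffU coeff_simple mulrC.
Qed.

Lemma act_srefl (D : dynkin) (x y : D) :
  weyl_act (simple_reflection x) (simple_root y)
  = simple_root y - simple_root x *~ cartan x y.
Proof.
by rewrite weyl_act_simple -(pairing_root (fundLattice D)) pairing_simple.
Qed.

Lemma act_srefl_self (D : dynkin) (x : D) :
  weyl_act (simple_reflection x) (simple_root x) = - simple_root x.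
Proof. by rewrite act_srefl cartan_diag mulr2n opprD addNKr. Qed.

Definition nonneg (D : dynkin) (g : rootLattice D) : Prop :=
  forall z, 0 <= coeff z g.

Lemma nonneg_anti (D : dynkin) (g : rootLattice D) :
  nonneg g -> nonneg (- g) -> g = 0.
Proof.
move=> g0 Ng0; apply/eqP/freeg_eqP => z; apply/eqP.
by rewrite coeff0 eq_le g0 -oppr_ge0 -coeffN Ng0.
Qed.

(** * Length *)

Fact length_subproof (D : dynkin) (w : weyl D) :
  exists n, `[< exists2 s, w = word s & size s = n >].
Proof.
by have [s ws] := exists_word w; exists (size s); apply/asboolP; exists s.
Qed.

Definition length (D : dynkin) (w : weyl D) : nat := ex_minn (length_subproof w).

Lemma reduced_word (D : dynkin) (w : weyl D) :
  exists2 s, w = word s & size s = length w.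
Proof. by rewrite /length; case: ex_minnP => n /asboolP. Qed.

Lemma length_word (D : dynkin) (s : seq D) : (length (word s) <= size s)%N.
Proof.
by rewrite /length; case: ex_minnP => n _; apply; apply/asboolP; exists s.
Qed.

Lemma lengthM (D : dynkin) (u v : weyl D) :
  (length (u * v)%g <= length u + length v)%N.
Proof.
have [[s -> <-] [t -> <-]] := (reduced_word u, reduced_word v).
by rewrite -word_cat -size_cat length_word.
Qed.

Lemma lengthV (D : dynkin) (w : weyl D) : length w^-1%g = length w.
Proof.
have le u : (length (u^-1)%g <= length (u : weyl D))%N.
  by have [s -> <-] := reduced_word u; rewrite wordV -size_rev length_word.
by apply/eqP; rewrite eqn_leq le -{1}[w]invgK le.
Qed.

Lemma length_srefl (D : dynkin) (x : D) : (length (simple_reflection x) <= 1)%N.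
Proof. by have := length_word [:: x]; rewrite /word big_seq1. Qed.

(** * Two simple reflections *)

(** The letters alternate and the last one is [y]; the first one depends on the
    parity of [k]. *)
Fixpoint alt (T : Type) (x y : T) (k : nat) : seq T :=
  if k is k'.+1 then rcons (alt y x k') y else [::].

Lemma size_alt (T : Type) (x y : T) k : size (alt x y k) = k.
Proof. by elim: k x y => //= k IH x y; rewrite size_rcons IH. Qed.

Lemma altD (T : Type) (x y : T) m r :
  exists2 p, size p = r & alt x y (m + r) = p ++ alt x y m.
Proof.
elim: m x y => [|m IH] x y; first by exists (alt x y r); rewrite ?size_alt ?cats0.
by have [p pr e] := IH y x; exists p => //; rewrite addSn /= e rcons_cat.
Qed.

(** Moving a letter across the dihedral factor either lengthens that factor or
    cancels its first letter. *)
Lemma alt_cons (T : eqType) (x y z : T) k : z \in [:: x; y] -> (0 < k)%N ->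
  z :: alt x y k = alt x y k.+1 \/ alt x y k = z :: alt x y k.-1.
Proof.
elim: k x y => // -[|k] IH x y zxy _.
  move: zxy; rewrite !inE => /orP[] /eqP ->; [by left|by right].
have zyx : z \in [:: y; x] by move: zxy; rewrite !inE orbC.
case: (IH _ _ zyx isT) => e; [left|right].
  by rewrite -[alt x y k.+3]/(rcons (alt y x k.+2) y) -e.
by rewrite -[alt x y k.+2]/(rcons (alt y x k.+1) y) e.
Qed.

(** The recurrence satisfied by a fixed coordinate of the images of the simple roots
    of [x] and [y] under alternating words, for [a = cartan x y] and
    [b = cartan y x]; see [alt_recurrence]. *)
Definition rank2_recurrence (a b : int) (F G : nat -> int) : Prop :=
  [/\ F 1%N = F 0%N - b * G 0%N, G 1%N = G 0%N - a * F 0%N,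
      forall k, F k.+2 = - b * G k.+1 - F k
    & forall k, G k.+2 = - a * F k.+1 - G k].

Lemma rank2_positive_infinite (F G : nat -> int) (a b : int) :
    a <= 0 -> b <= 0 -> 4 <= a * b -> rank2_recurrence a b F G ->
    0 <= F 0%N -> 0 <= G 0%N ->
  forall k, 0 <= F k.
Proof.
move=> a0 b0 ab [F1 G1 FS GS] F0 G0.
(* The subtracted term never exceeds half of the term it is subtracted from: from
   - a F_k <= 2 G_(k+1) and a b >= 4 follows 2 F_k <= - b G_(k+1), whence
   - b G_(k+1) <= 2 F_(k+2). *)
suff H k : [/\ 0 <= F k, 0 <= G k,
               - b * G k <= 2 * F k.+1 & - a * F k <= 2 * G k.+1].
  by move=> k; case: (H k).
elim: k => [|k [Fk Gk bG aF]]; first by rewrite F1 G1; split => //; nia.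
have F1k : 0 <= F k.+1 by nia.
have G1k : 0 <= G k.+1 by nia.
have Na : 0 <= - a by rewrite oppr_ge0.
have Nb : 0 <= - b by rewrite oppr_ge0.
rewrite FS GS; split=> //.
  have := ler_wpM2l Nb aF; have : 4 * F k <= a * b * F k by nia.
  nia.
have := ler_wpM2l Na bG; have : 4 * G k <= a * b * G k by nia.
nia.
Qed.

Definition finite_rank2 : seq (int * int) :=
  [:: (0, 0); (-1, -1); (-1, -2); (-2, -1); (-1, -3); (-3, -1)].

Lemma small_cartan (D : dynkin) (x y : D) : x != y ->
  cartan x y * cartan y x < 4 -> (cartan x y, cartan y x) \in finite_rank2.
Proof.
move=> xy; have := cartan_offdiag xy.
have : cartan y x <= 0 by apply: cartan_offdiag; rewrite eq_sym.
have := @cartan_eq0 D x y; have := @cartan_eq0 D y x.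
rewrite !inE !xpair_eqE; set a := cartan x y; set b := cartan y x.
move=> ba ab b0 a0 lt4.
have [a_eq0|a_neq0] := eqVneq a 0; first by rewrite ab // eqxx.
have b_neq0 : b != 0 by apply: contra_neq a_neq0; exact: ba.
have a3 : -3 <= a by nia.
have b3 : -3 <= b by nia.
have : [|| a == -1, a == -2 | a == -3] by lia.
by case/or3P => /eqP ea; rewrite ea in lt4 *; lia.
Qed.

(** The order of the product of two simple reflections, in terms of the product of
    the off-diagonal Cartan entries; meaningful for n < 4 only. *)
Definition braid_order (n : int) : nat :=
  if n == 0 then 2 else if n == 1 then 3 else if n == 2 then 4 else 6.

Lemma rank2_positive_finite (F G : nat -> int) (a b : int) :
    (a, b) \in finite_rank2 -> rank2_recurrence a b F G ->
    0 <= F 0%N -> 0 <= G 0%N ->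
  forall k, (k < braid_order (a * b))%N -> 0 <= F k.
Proof.
move=> + [F1 G1 FS GS] F0 G0 k; rewrite !inE.
by do 5?case/orP; move=> /eqP[ea eb]; rewrite {}ea {}eb in F1 G1 FS GS *;
  case: k => [|[|[|[|[|[|]]]]]] // _; rewrite ?(FS, GS); lia.
Qed.

(** An element of the dihedral subgroup moves a weight [p] by a combination of the
    two simple roots, so that relations between [x] and [y] reduce to identities
    between the coordinates [c] and [d]. *)
Lemma rank2_act (D : dynkin) (x y : D) (p : fundLattice D) (c d : int) :
  reflection x (p + root_emb _ (simple_root x *~ c + simple_root y *~ d))
  = p + root_emb _
      (simple_root x *~ (- c - pairing p (simple_coroot x) - cartan x y * d)
       + simple_root y *~ d).
Proof.
rewrite reflectionE -addrA -root_embB; congr (_ + root_emb _ _).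
rewrite pairingDl root_emb_additive pairingDl !root_embMz !pairingMzl.
rewrite !pairing_simple cartan_diag !mulrzz addrAC -mulrzBr; congr (_ *~ _ + _).
ring.
Qed.

Lemma braid (D : dynkin) (x y : D) :
    (cartan x y, cartan y x) \in finite_rank2 ->
  let m := braid_order (cartan x y * cartan y x) in
  word (alt x y m) = word (alt y x m).
Proof.
have Rx := @rank2_act D x y.
have Ry p c d : reflection y (p + root_emb (fundLattice D)
      (simple_root x *~ c + simple_root y *~ d))
    = p + root_emb _ (simple_root x *~ c + simple_root y
      *~ (- d - pairing p (simple_coroot y) - cartan y x * c)).
  by rewrite [in LHS](addrC (_ *~ c)) rank2_act [X in root_emb _ X]addrC.
(* Starting from zero coordinates puts both sides in the form that [Rx] and [Ry]
   rewrite. *)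
have E s t : (forall p,
      reflections s (p + root_emb _ (simple_root x *~ 0 + simple_root y *~ 0))
    = reflections t (p + root_emb _ (simple_root x *~ 0 + simple_root y *~ 0))) ->
  word s = word t.
  have emb0 : root_emb (fundLattice D) 0 = 0 by [].
  move=> st; apply: weylP => p; have := st p.
  by rewrite !word_reflections !mulr0z addr0 emb0 addr0.
have Ex (p : fundLattice D) c d c' d' : c = c' -> d = d' ->
    p + root_emb _ (simple_root x *~ c + simple_root y *~ d)
  = p + root_emb _ (simple_root x *~ c' + simple_root y *~ d') by move=> -> ->.
rewrite !inE => cxy m; rewrite {}/m.
by do 5?[case/orP: cxy => cxy]; case/eqP: cxy => axy ayx; apply: E => p;
  rewrite axy ayx /= !(Rx, Ry) axy ayx; apply: Ex; ring.
Qed.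

(** * Positivity of roots *)

Lemma weyl_act_pair (D : dynkin) (w : weyl D) (x y : D) :
  weyl_act (w * simple_reflection y)%g (simple_root x)
  = weyl_act w (simple_root x) - weyl_act w (simple_root y) *~ cartan y x.
Proof. by rewrite weyl_actM act_srefl raddfB raddfMz. Qed.

Lemma alt_recurrence (D : dynkin) (v : weyl D) (x y z : D) k :
  let F a b k := coeff z (weyl_act (v * word (alt a b k))%g (simple_root a)) in
  F x y k.+2 = - cartan y x * F y x k.+1 - F x y k.
Proof.
have e : weyl_act (v * word (alt y x k.+1))%g (simple_root x)
         = - weyl_act (v * word (alt x y k))%g (simple_root x).
  by rewrite /= word_rcons mulgA [LHS]weyl_actM act_srefl_self raddfN.
move=> F; rewrite {1}/F [alt x y k.+2]/(rcons (alt y x k.+1) y) word_rcons mulgA.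
by rewrite weyl_act_pair coeffB coeffMz e coeffN mulNr addrC mulrC.
Qed.

(** The hypothesis on [k] says that appending [x] does not shorten the alternating
    word. *)
Lemma alt_positive (D : dynkin) (v : weyl D) (x y : D) : x != y ->
    nonneg (weyl_act v (simple_root x)) -> nonneg (weyl_act v (simple_root y)) ->
  forall k,
    (forall s, word (alt x y k) = word (rcons s x) -> (k <= size s)%N) ->
  nonneg (weyl_act (v * word (alt x y k))%g (simple_root x)).
Proof.
move=> xy vx vy k kmin z.
pose F a b k := coeff z (weyl_act (v * word (alt a b k))%g (simple_root a)).
have F0 a b : F a b 0%N = coeff z (weyl_act v (simple_root a)).
  by rewrite /F word_nil mulg1.
have F1 a b : F a b 1%N = F a b 0%N - cartan b a * F b a 0%N.
  rewrite !F0 /F word_cons word_nil mulg1 weyl_act_pair coeffB coeffMz.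
  by rewrite mulrC.
have F2 a b n : F a b n.+2 = - cartan b a * F b a n.+1 - F a b n.
  exact: alt_recurrence.
have rec : rank2_recurrence (cartan x y) (cartan y x) (F x y) (F y x).
  by split; [exact: F1 | exact: F1 | move=> n; exact: F2 | move=> n; exact: F2].
rewrite -[coeff _ _]/(F x y k).
have [lt4|ge4] := ltP (cartan x y * cartan y x) 4; last first.
  by apply: (rank2_positive_infinite _ _ ge4 rec); rewrite ?F0 //;
    apply: cartan_offdiag => //; rewrite eq_sym.
have fin := small_cartan xy lt4.
apply: (rank2_positive_finite fin rec); rewrite ?F0 //.
rewrite ltnNge; apply/negP => mk; have := braid fin.
have : (0 < braid_order (cartan x y * cartan y x))%N.
  by rewrite /braid_order; do 3!case: ifP => // _.
case: (braid_order _) mk => // m mk _ /= bm.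
(* The braid relation makes the word end in [x], which [kmin] excludes. *)
have [p sp e] := altD x y m.+1 (k - m.+1); rewrite subnKC // in e.
have /kmin : word (alt x y k) = word (rcons (p ++ alt x y m) x).
  by rewrite e word_cat bm -word_cat /= rcons_cat.
by rewrite size_cat sp size_alt; lia.
Qed.

(** Write [w = v * u] with lengths adding up, [u] a nonempty alternating word in [x]
    and a descent [y] of [w], and [v] as short as possible.  Then neither [x] nor
    [y] is a descent of [v], which by induction sends both simple roots to
    nonnegative vectors; and [u] sends the simple root of [x] to a nonnegative
    combination of the two. *)
Lemma ascent_positive (D : dynkin) (w : weyl D) (x : D) :
    (length w <= length (w * simple_reflection x)%g)%N ->
  nonneg (weyl_act w (simple_root x)).
Proof.
have [n] := ubnP (length w); elim: n w x => // n IH w x /ltnSE wn asc.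
have [s ws ss] := reduced_word w.
case: (lastP s) ws ss => [|s' y] ws ss.
  by rewrite ws word_nil weyl_act1 => z; rewrite coeff_simple.
have wy : (w * simple_reflection y)%g = word s'.
  by rewrite ws word_rcons sreflK.
have xy : x != y.
  apply: contraTneq asc => ->; rewrite -ltnNge wy.
  by rewrite (leq_ltn_trans (length_word s')) // -ss size_rcons.
pose fact v := exists k, [/\ (0 < k)%N, w = (v * word (alt x y k))%g
  & (length (v : weyl D) + k = length w)%N].
have fact0 : exists m, `[< exists2 v, fact v & length v = m >].
  exists (length (word s')); apply/asboolP; exists (word s') => //.
  have alt1 : word (alt x y 1) = simple_reflection y by rewrite /= /word big_seq1.
  exists 1%N; split=> //; first by rewrite alt1 -word_rcons.
  apply/eqP; rewrite eqn_leq -{1}ss size_rcons addn1 ltnS length_word /=.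
  rewrite -wy -{1}[w](sreflK y) -addn1 (leq_trans (lengthM _ _)) //.
  by rewrite leq_add2l length_srefl.
(* [v] is the shortest possible left factor. *)
have [m /asboolP[v [k [k0 wvk lenw] <-]] vmin] := ex_minnP fact0.
have vz z : z \in [:: x; y] -> (length v <= length (v * simple_reflection z)%g)%N.
  move=> zxy; rewrite leqNgt; apply/negP => dec.
  have wz : w = (v * simple_reflection z * word (z :: alt x y k))%g.
    by rewrite word_cons mulgA sreflK.
  have [e|e] := alt_cons zxy k0; last first.
    have := lengthM (v * simple_reflection z)%g (word (alt x y k.-1)).
    rewrite -mulgA -word_cons -e -wvk.
    by have := length_word (alt x y k.-1); rewrite size_alt; lia.
  rewrite e in wz.
  have le_w : (length w <= length (v * simple_reflection z)%g + k.+1)%N.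
    rewrite [w in leqLHS]wz (leq_trans (lengthM _ _)) // leq_add2l.
    by rewrite (leq_trans (length_word _)) // size_alt.
  have /vmin : `[< exists2 u, fact u & length u = length (v * simple_reflection z)%g >].
    apply/asboolP; exists (v * simple_reflection z)%g => //.
    by exists k.+1; split=> //; lia.
  by rewrite leqNgt dec.
rewrite wvk; apply: alt_positive => //.
- by apply: IH; [lia|apply: vz; rewrite inE eqxx].
- by apply: IH; [lia|apply: vz; rewrite !inE eqxx orbT].
move=> r er; move: asc; rewrite [X in (X * _)%g]wvk er word_rcons mulgA sreflK.
by move=> /leq_trans /(_ (lengthM _ _)); have := length_word r; lia.
Qed.

Lemma reduced_prefix_nonneg (D : dynkin) (s : seq D) (x : D) (t : seq D) :
  length (word (s ++ x :: t)) = size (s ++ x :: t) ->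
  nonneg (weyl_act (word s) (simple_root x)).
Proof.
move=> red; apply: ascent_positive; rewrite -word_rcons.
have := lengthM (word (rcons s x)) (word t).
rewrite -word_cat cat_rcons red size_cat /=.
by have := length_word t; have := length_word s; lia.
Qed.

(** The image under the inverse of [word (s ++ x :: t)] is minus a root of the same
    kind for the reversed word, which is reduced too. *)
Lemma reduced_suffix_nonpos (D : dynkin) (s : seq D) (x : D) (t : seq D) :
  length (word (s ++ x :: t)) = size (s ++ x :: t) ->
  nonneg (- weyl_act (word (s ++ x :: t))^-1%g
              (weyl_act (word s) (simple_root x))).
Proof.
move=> red; rewrite -weyl_actM word_cat word_cons invgM -mulgA mulVg mulg1.
rewrite -word_cons wordV rev_cons word_rcons weyl_actM act_srefl_self raddfN opprK.
apply: (reduced_prefix_nonneg (t := rev s)).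
have -> : rev t ++ x :: rev s = rev (s ++ x :: t).
  by rewrite rev_cat rev_cons cat_rcons.
by rewrite -wordV lengthV size_rev.
Qed.

(** * Distances and supports *)

Lemma least_le (A : set nat) n : A n -> exists2 m, least A = Some m & (m <= n)%N.
Proof.
move=> An; rewrite /least; case: pselect => [A0|]; last first.
  by case; exists n; apply/asboolP.
by case: ex_minnP => m _ mmin; exists m => //; apply: mmin; apply/asboolP.
Qed.

Lemma distance_to_le (D : dynkin) (Y : set D) (x : D) (p : seq D) :
    path (@adjacent D) x p -> Y (last x p) ->
  exists2 n, distance_to Y x = Some n & (n <= size p)%N.
Proof.
move=> xp Yp; have [|m dm mp] := @least_le
    [set n | exists2 q, path (@adjacent D) x q
                      & last x q = last x p /\ size q = n]
    (size p); first by exists p.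
have [|n dn nm] := @least_le [set n | exists2 y, Y y & distance x y = Some n] m.
  by exists (last x p).
by exists n => //; apply: leq_trans mp.
Qed.

(** A simple reflection changes a single coordinate, and only if its vertex is in
    the support or adjacent to it: the support spreads by at most one edge per
    letter. *)
Lemma word_support (D : dynkin) (s : seq D) (x z : D) :
    coeff z (weyl_act (word s) (simple_root x)) != 0 ->
  exists2 p, path (@adjacent D) x p & last x p = z /\ (size p <= size s)%N.
Proof.
elim: s z => [|y s IH] z.
  rewrite word_nil weyl_act1 coeff_simple.
  by have [<-|] := eqVneq x z; [exists [::]|rewrite eqxx].
rewrite word_cons weyl_actM weyl_act_simple; set g := weyl_act _ _ in IH *.
rewrite coeffB coeffMz coeff_simple.
have [gz|/IH[p xp [pz ps]] _] := eqVneq (coeff z g) 0; last first.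
  by exists p => //; split=> //; apply: leqW.
have [yz|] := eqVneq y z; last by rewrite gz mul0r subr0 eqxx.
rewrite -{z}yz in gz *; rewrite gz sub0r oppr_eq0 mul1r => gy.
have [u gu cyu] : exists2 u, coeff u g != 0 & cartan y u != 0.
  apply: contrapT => nou; case/negP: gy; apply/eqP.
  rewrite /std_pairing domU1 big_seq1 big1 // => u _.
  have [->|gu] := eqVneq (coeff u g) 0; first by rewrite mul0r mulr0.
  have [->|cu] := eqVneq (cartan y u) 0; first by rewrite !mulr0.
  by case: nou; exists u.
have [p xp [pu ps]] := IH u gu.
exists (rcons p y); last by rewrite last_rcons size_rcons.
rewrite rcons_path xp pu /adjacent /=; apply/andP; split.
  by apply: contraNneq gu => ->; rewrite gz.
by apply: contra_neq cyu; exact: cartan_eq0.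
Qed.

(** * Coefficients outside X of the roots of an X-reduced element *)

Lemma set_coeffB (D : dynkin) (Z : set D) :
  {morph set_coeff Z : g h / g - h}.
Proof.
have E g : set_coeff Z g = \sum_(x <- dom g) coeff x g * (x \in Z)%:R.
  rewrite /set_coeff big_mkcond /=; apply: eq_bigr => x _.
  by case: ifP => _; rewrite ?mulr1 ?mulr0.
move=> g h; apply: (addIr (set_coeff Z h)).
by rewrite subrK 3!E -(sum_dom_additive (fun x => (x \in Z)%:R)) subrK.
Qed.

HB.instance Definition _ (D : dynkin) (Z : set D) :=
  GRing.isZmodMorphism.Build _ _ (set_coeff Z) (@set_coeffB D Z).

Lemma set_coeff_eq0 (D : dynkin) (Z : set D) (g : rootLattice D) :
  nonneg g -> set_coeff Z g <= 0 -> forall z, Z z -> coeff z g = 0.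
Proof.
move=> g0 gZ z Zz; have [//|gz] := eqVneq (coeff z g) 0.
have /eqP : set_coeff Z g = 0.
  by apply/eqP; rewrite eq_le gZ; apply: sumr_ge0 => x _; exact: g0.
rewrite psumr_eq0 => [/allP /(_ z)|x _]; last exact: g0.
by rewrite mem_dom => /(_ gz); rewrite mem_set //= => /eqP.
Qed.

Lemma weyl_act_root (D : dynkin) (w : weyl D) (x : D) :
  root_system setT (weyl_act w (simple_root x)).
Proof. by exists w, x; split=> //; have [s ->] := exists_word w; exists s. Qed.

(** Otherwise the simple root of [x] would be an inversion root of [w]. *)
Lemma X_reduced_nonneg (D : dynkin) (X : set D) (w : weyl D) (x : D) :
  X_reduced X w -> X x -> nonneg (weyl_act w^-1%g (simple_root x)).
Proof.
move=> wX Xx; have [asc|desc] :=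
  leqP (length w^-1%g) (length (w^-1 * simple_reflection x)%g).
  exact: ascent_positive.
have /ascent_positive : (length (w^-1 * simple_reflection x)%g
    <= length (w^-1 * simple_reflection x * simple_reflection x)%g)%N.
  by rewrite sreflK ltnW.
rewrite weyl_actM act_srefl_self raddfN => neg.
suff : (inversions w `&` root_system X) (simple_root x) by rewrite wX.
split; last by exists 1%g, x; split=> //; exists [::] => //; rewrite big_nil.
split.
  split=> [|z]; first by rewrite -[simple_root x]weyl_act1; exact: weyl_act_root.
  by rewrite coeff_simple.
exists (weyl_act w^-1%g (simple_root x)).
  split=> [|z]; first exact: weyl_act_root.
  by rewrite -oppr_ge0 -coeffN; exact: neg.
by rewrite -weyl_actM mulgV.
Qed.

(** A root of the word with vanishing coefficients outside [X] would be sent by the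
    inverse of the word to a vector that is both nonnegative and nonpositive. *)
Lemma X_reduced_set_coeff (D : dynkin) (X : set D) (s t : seq D) (x : D) :
    X_reduced X (word (s ++ x :: t)) ->
    length (word (s ++ x :: t)) = size (s ++ x :: t) ->
  0 < set_coeff (~` X) (weyl_act (word s) (simple_root x)).
Proof.
set w := word _ => wX red; set b := weyl_act (word s) _.
have b0 : nonneg b := reduced_prefix_nonneg red.
have wb : nonneg (- weyl_act w^-1%g b) := reduced_suffix_nonpos red.
rewrite ltNge; apply/negP => /(set_coeff_eq0 b0) bX.
suff : coeff x (simple_root x) = 0 by rewrite coeff_simple eqxx.
rewrite -[simple_root x]weyl_act1 -(mulVg (word s)) weyl_actM -/b.
rewrite -[b]weyl_act1 -(mulgV w) [weyl_act (w * _)%g _]weyl_actM.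
rewrite (_ : weyl_act w^-1%g b = 0) ?raddf0 //.
apply: nonneg_anti => // z.
rewrite weyl_actE_sum raddf_sum; apply: sumr_ge0 => y _ /=.
rewrite coeffMz; have [->|by0] := eqVneq (coeff y b) 0; first by rewrite mulr0.
rewrite mulr_ge0 ?b0 //; apply: (X_reduced_nonneg wX).
by apply: contrapT => /bX /eqP; rewrite (negPf by0).
Qed.

(** * Displacement of dominant weights *)

Lemma root_embN (D : dynkin) (P : weightLattice D) (g : rootLattice D) :
  root_emb P (- g) = - root_emb P g.
Proof.
have emb0 : root_emb P 0 = 0 by rewrite -(subrr 0) root_embB subrr.
by rewrite -sub0r root_embB emb0 sub0r.
Qed.

(** The telescoping step for the weight whose pairing with the simple coroot of each
    vertex is given by [f]. *)
Lemma weyl_fund_rcons (D : dynkin) (s : seq D) (x : D) (f : D -> int) :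
  (word (rcons s x) (0, f)).1
  = (word s (0, f)).1 - weyl_act (word s) (simple_root x) *~ f x.
Proof.
have e : reflection x ((0, f) : fundLattice D)
       = (0, f) - root_emb (fundLattice D) (simple_root x *~ f x).
  rewrite reflectionE fund_pairing /std_pairing big1 ?add0r // => y _.
  by rewrite dom0 big_nil.
rewrite word_rcons -raddfMz.
transitivity (word s (@reflection D (fundLattice D) x (0, f))).1 => //.
by rewrite e weylB weyl_actE.
Qed.

(** Each letter contributes a positive multiple of the [Z]-coefficient of its
    root. *)
Lemma size_le_set_coeff (D : dynkin) (Z : set D) (s : seq D) (f : D -> int) :
    (forall x, 0 < f x) ->
    (forall r x t, s = r ++ x :: t ->
       0 < set_coeff Z (weyl_act (word r) (simple_root x))) ->
  (size s)%:Z <= set_coeff Z (- (word s (0, f)).1).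
Proof.
move=> f0; elim/last_ind: s => [|s x IH] sZ.
  have -> : (word [::] (0, f)).1 = 0 by rewrite word_nil.
  by rewrite oppr0 [set_coeff Z 0]raddf0.
rewrite weyl_fund_rcons opprB addrC size_rcons -addn1 PoszD.
rewrite [set_coeff _ _]raddfD [X in _ <= _ + X]raddfMz mulrzz lerD //.
  by apply: IH => r y t st; apply: (sZ r y (rcons t x)); rewrite st rcons_cat.
have b0 := sZ s x [::]; rewrite cats1 in b0.
by rewrite -gtz0_ge1 mulr_gt0 ?b0.
Qed.

Theorem mainTheorem3 (D : dynkin) (X : set D) (P : weightLattice D)
    (phi : P) (hphi : dominant phi)
    (w : weyl D) (hw : X_reduced X w)
    (j : int) (gamma : rootLattice D)
    (hgamma : phi - dot w phi = root_emb P gamma)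
    (hj : set_coeff (~` X) gamma = j) :
  parabolic (nearby (~` X) j) w.
Proof.
have [s ws red] := reduced_word w; rewrite {}ws in hw hgamma red *.
pose f x := pairing phi (simple_coroot x) + 1.
(* [(0, f)] has the same pairings as [phi + rho], and [gamma] is the difference
   between this weight and its image under [word s]. *)
have gammaE : gamma = - (word s (0, f)).1.
  apply: (@root_emb_inj _ P); rewrite -hgamma /dot -/f opprD addrA subrr sub0r.
  by rewrite root_embN.
have Ypos r x t (srt : s = r ++ x :: t) :
    0 < set_coeff (~` X) (weyl_act (word r) (simple_root x)).
  by apply: (@X_reduced_set_coeff _ _ r t); rewrite -srt.
have sj : (size s)%:Z <= j.
  rewrite -hj gammaE; apply: size_le_set_coeff => // x.
  by have := hphi x; rewrite /f; lia.
exists s => // x /splitPr xs; case: xs Ypos sj {red hw gammaE hgamma} => r t Ypos sj.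
have [z Yz rz] : exists2 z, (~` X) z
    & coeff z (weyl_act (word r) (simple_root x)) != 0.
  apply: contrapT => noz; have := Ypos r x t erefl; rewrite ltNge => /negP[].
  rewrite /set_coeff big1 // => z; rewrite in_setE => Yz.
  by apply/eqP; apply: contrapT => /negP rz; apply: noz; exists z.
have [p xp [pz pr]] := word_support rz.
have [|n dn np] := distance_to_le xp (Y := ~` X); first by rewrite pz.
exists n => //; move: sj; rewrite size_cat /=; lia.
Qed.
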